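(* Let $N=pd$ with $p,d$ positive integers, let $q_1,\dots,q_K$ be all the positive divisors of $N$, and suppose that $\mathcal R_{p,N}$ is a tight frame for $\ell^2(\mathbb Z_N)$. Fix $\mathcal M\subset\{0,\dots,d-1\}\times\{1,\dots,K\}$ with complement $\mathcal M^c$ in $\{0,\dots,d-1\}\times\{1,\dots,K\}$, and let $$x\in\mathcal S_{\mathcal M}:=\{h\in\ell^2(\mathbb Z_N):(h*c_{q_i})(pk)=0\text{ for all }(k,i)\in\mathcal M^c\}.$$ Let $\eta\in\ell^2(\mathbb Z_N)$ be a noise vector with support $\mathcal N=\{m\in\mathbb Z_N:\eta(m)\ne0\}$. If $$2\,\#\mathcal M\,\#\mathcal N<p\left(\frac{d}{\phi(N)}\right)^2,$$ then the signal $x$ can be exactly recovered from the noisy observation $y=x+\eta$.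
   Context: $\ell^2(\mathbb Z_N)$ is the $N$-dimensional complex Hilbert space of functions on $\mathbb Z_N=\{0,1,\dots,N-1\}$ (identified with $N$-periodic functions on $\mathbb Z$), with $\langle x,y\rangle=\sum_{n=0}^{N-1}x(n)\overline{y(n)}$. For $m\in\mathbb Z$, the circular shift is $L_mx(n)=x(n-m)$. For a positive integer $q$, the $q$-th Ramanujan sum is $c_q(n)=\sum_{1\le k\le q,\,(k,q)=1}e^{2\pi i kn/q}$; it is $q$-periodic, so for $q\mid N$ it is regarded as an element of $\ell^2(\mathbb Z_N)$. $\phi$ is Euler's totient function. The circular convolution is $(x*y)(n)=\sum_{m=0}^{N-1}x(m)y(n-m)$. $\mathcal R_{p,N}$ denotes the family $(L_{pk}c_{q_i})$ indexed by $(k,i)\in\{0,\dots,d-1\}\times\{1,\dots,K\}$. A finite family $(f_j)$ is a tight frame for $\ell^2(\mathbb Z_N)$ with bound $A>0$ if $\sum_j|\langle x,f_j\rangle|^2=A\|x\|^2$ for all $x\in\ell^2(\mathbb Z_N)$. $\#$ denotes cardinality. *)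

(* Defs.v *)
From HB Require Import structures.
From mathcomp Require Import all_boot all_order all_algebra.
From mathcomp Require Import all_classical all_reals all_analysis.
From mathcomp Require Import complex.
Set Implicit Arguments.
Unset Strict Implicit.
Unset Printing Implicit Defensive.
Import Order.TTheory GRing.Theory Num.Theory.
Local Open Scope ring_scope.
Local Open Scope complex_scope.

(* A finite function carries the pointwise addition of signals.  We use 'I_N
   and not 'Z_N, since the latter does not have N elements for N = 1. *)
Notation ell2 R N := {ffun 'I_N -> R[i]}.

(* For N > 0 this is the N-periodic extension of x to the integers;
   the default value 0 is only reached when N = 0. *)
Definition periodize (R : realType) (N : nat) (x : ell2 R N) (n : int) : R[i] :=
  if insub `|(n %% N)%Z|%N is Some i then x i else 0.

Definition inner (R : realType) (N : nat) (x y : ell2 R N) : R[i] :=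
  \sum_(n < N) x n * (y n)^*.

Definition circ_shift (R : realType) (N : nat) (m : int) (x : ell2 R N) : ell2 R N :=
  [ffun n : 'I_N => periodize x (n%:Z - m)].

Definition circ_conv (R : realType) (N : nat) (x y : ell2 R N) : ell2 R N :=
  [ffun n : 'I_N => \sum_(m < N) x m * periodize y (n%:Z - m%:Z)].

(* e^{i t} *)
Definition expi (R : realType) (t : R) : R[i] := cos t +i* sin t.

Definition ramanujan_sum (R : realType) (q : nat) (n : int) : R[i] :=
  \sum_(1 <= k < q.+1 | coprime k q)
     expi (2 * pi * k%:R * n%:~R / q%:R : R).

(* The Ramanujan sum as a signal; it is only meaningful when q divides N. *)
Definition ramanujan (R : realType) (N q : nat) : ell2 R N :=
  [ffun n : 'I_N => ramanujan_sum R q n%:Z].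
Arguments ramanujan : clear implicits.

Definition ramanujan_family (R : realType) (p d K : nat) (q : K.-tuple nat)
    (j : 'I_d * 'I_K) : ell2 R (p * d) :=
  circ_shift (p * j.1)%N%:Z (ramanujan R (p * d) (tnth q j.2)).
Arguments ramanujan_family : clear implicits.
Arguments ramanujan_family R p d {K} q j.

Definition tight_frame (R : realType) (N : nat) (J : finType)
    (f : J -> ell2 R N) : Prop :=
  exists2 A : R, 0 < A &
    forall x : ell2 R N, \sum_j `|inner x (f j)| ^+ 2 = A%:C * inner x x.

Definition in_S (R : realType) (p d K : nat) (q : K.-tuple nat)
    (M : {set 'I_d * 'I_K}) (h : ell2 R (p * d)) : Prop :=
  forall j : 'I_d * 'I_K, j \in ~: M ->
    periodize (circ_conv h (ramanujan R (p * d) (tnth q j.2))) (p * j.1)%N%:Z = 0.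

Definition noise_support (R : realType) (N : nat) (eta : ell2 R N) : {set 'I_N} :=
  [set m | eta m != 0]%SET.

(* Main.v *)
(* An uncertainty principle. Two decodings of the same observation differ by some
   h in S_M whose support has at most #N + #N' points. The coefficients
   (h * c_q)(pk) are the frame coefficients <h, L_{pk} c_q>, so only those indexed
   by M survive, and each is at most phi(N) |h|_1 since |c_q| <= phi(q) <= phi(N).
   With Cauchy-Schwarz on the support of h, the frame identity gives
   A <= #M #supp(h) phi(N)^2 unless h = 0. As A >= dN = p d^2, the hypothesis
   forces h = 0. *)

Require Import Defs.
From mathcomp Require Import all_boot all_order all_algebra.
From mathcomp Require Import all_classical all_reals all_analysis.
From mathcomp Require Import complex ring.
Import Order.TTheory GRing.Theory Num.Theory.
Local Open Scope ring_scope.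

(** * Monotonicity of the totient and Cauchy-Schwarz *)

Lemma leq_totient_dvdn (m n : nat) :
  (0 < n)%N -> (m %| n)%N -> (totient m <= totient n)%N.
Proof.
move=> n0 mn; have m0 : (0 < m)%N by exact: dvdn_gt0 mn.
have subm : {subset primes m <= primes n}.
  move=> r; rewrite !mem_primes => /and3P[-> _ rm].
  by rewrite n0 (dvdn_trans rm mn).
have perm_split : perm_eq (primes n)
    (primes m ++ [seq r <- primes n | r \notin primes m]).
  apply: uniq_perm; first exact: primes_uniq.
    rewrite cat_uniq primes_uniq filter_uniq ?primes_uniq// andbT.
    by apply/hasPn => r; rewrite mem_filter => /andP[].
  move=> r; rewrite mem_cat mem_filter.
  by case: (boolP (r \in primes m)) => [/subm|].
(* In the Euler products, each prime of [m] gives a factor that grows with its exponent, and the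
   primes of [n] alone give factors at least 1. *)
rewrite !totientE// (perm_big _ perm_split) big_cat /=.
rewrite -[X in (X <= _)%N]muln1; apply: leq_mul.
  rewrite [X in (X <= _)%N]big_seq [X in (_ <= X)%N]big_seq.
  apply: leq_prod => r; rewrite mem_primes => /and3P[pr _ _].
  rewrite leq_mul2l leq_pexp2l ?prime_gt0 ?orbT//.
  by rewrite -!subn1 leq_sub2r// dvdn_leq_log.
rewrite big_seq; apply: prodn_cond_gt0 => r.
rewrite mem_filter mem_primes => /andP[_ /andP[pr _]].
by case: r pr => [|[|r]] // _; rewrite muln_gt0 expn_gt0.
Qed.

(** Cauchy-Schwarz against the indicator of [S]: expand the square and apply the
    arithmetic-geometric mean inequality to each product. *)
Lemma sqr_sum_norm_le (F : numFieldType) (I : finType) (S : {set I})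
    (a : I -> F) :
  (\sum_(i in S) `|a i|) ^+ 2 <= #|S|%:R * \sum_(i in S) `|a i| ^+ 2.
Proof.
rewrite expr2 big_distrl /=.
under eq_bigr do rewrite big_distrr /=.
apply: (@le_trans _ _ (\sum_(i in S) \sum_(j in S)
   (`|a i| ^+ 2 / 2 + `|a j| ^+ 2 / 2))).
  apply: ler_sum => i _; apply: ler_sum => j _.
  rewrite -mulrDl.
  exact: (real_leif_mean_square (normr_real _) (normr_real _)).1.
under [leLHS]eq_bigr do
  rewrite big_split /= sumr_const -mulr_suml -[X in X + _]mulr_natl.
rewrite big_split /= sumr_const -[X in _ + X]mulr_natl -mulr_sumr -mulr_suml.
by rewrite -mulrDr -splitr.
Qed.

(** * Complex exponentials and Ramanujan sums *)

Section Ramanujan.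
Variable R : realType.

Lemma expi_conj (t : R) : (expi t)^* = expi (- t).
Proof. by rewrite /expi cosN sinN. Qed.

Lemma norm_expi (t : R) : `|expi t| = 1.
Proof. by rewrite normc_def /= cos2Dsin2 sqrtr1. Qed.

Lemma expiD2pi (t : R) (z : int) : expi (t + 2 * pi * z%:~R) = expi t.
Proof.
have nat_shift (s : R) (n : nat) : expi (s + 2 * pi * n%:R) = expi s.
  rewrite /expi mulr_natr [2 * pi]mulr_natl !periodicn//.
    exact: sinD2pi.
  exact: cosD2pi.
case: z => n; first by rewrite -pmulrn nat_shift.
by rewrite NegzE mulrNz -pmulrn mulrN -[LHS](nat_shift _ n.+1) subrK.
Qed.

Lemma ramanujan_sum_conj (r : nat) (n : int) :
  (ramanujan_sum R r n)^* = ramanujan_sum R r (- n).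
Proof.
rewrite /ramanujan_sum rmorph_sum; apply: eq_bigr => k _.
by rewrite /= expi_conj rmorphN /= mulrN mulNr.
Qed.

Lemma ramanujan_sum_modz (N r : nat) (n : int) :
  (0 < N)%N -> (r %| N)%N -> ramanujan_sum R r (n %% N)%Z = ramanujan_sum R r n.
Proof.
move=> N0 /dvdnP[s NE]; apply: eq_bigr => k _.
have r0 : (r%:R : R) != 0.
  by rewrite pnatr_eq0 -lt0n; move: N0; rewrite NE muln_gt0 => /andP[].
(* With [N = s * r], dropping the multiple of [N] from [n] changes the angle by this many full
   turns. *)
rewrite -(expiD2pi _ (k%:Z * s%:Z * (n %/ N)%Z)); congr expi.
have -> : (n%:~R : R) = (n %/ N)%Z%:~R * (s%:R * r%:R) + (n %% N)%Z%:~R.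
  by rewrite [in LHS](divz_eq n N) intrD intrM NE -natrM.
by rewrite !intrM -!pmulrn; field.
Qed.

Lemma periodize_ramanujan (N r : nat) (n : int) :
  (0 < N)%N -> (r %| N)%N ->
  periodize (ramanujan R N r) n = ramanujan_sum R r n.
Proof.
move=> N0 rN; rewrite /periodize; have N0' : N%:Z != 0 by rewrite eqz_nat -lt0n.
have nN : (`|(n %% N)%Z| < N)%N.
  by rewrite -ltz_nat gez0_abs ?modz_ge0// ltz_pmod.
rewrite insubT ffunE /= gez0_abs ?modz_ge0//.
exact: ramanujan_sum_modz.
Qed.

Lemma norm_ramanujan_sum_le (r : nat) (n : int) :
  (0 < r)%N -> `|ramanujan_sum R r n| <= (totient r)%:R.
Proof.
move=> r0; apply: le_trans (ler_norm_sum _ _ _) _.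
rewrite (eq_bigr (fun=> 1%:R)) => [|k _]; last exact: norm_expi.
rewrite -natr_sum ler_nat totient_count_coprime.
rewrite big_mkcond big_nat_recr//= [X in (_ <= X)%N]big_ltn//.
(* The Ramanujan sum runs over 1..r and the totient count over 0..r-1; the two end terms agree. *)
have -> : coprime r r = coprime r 0 by rewrite /coprime gcdnn gcdn0.
rewrite addnC leq_add//.
by apply: leq_sum => k _; rewrite coprime_sym; case: ifP.
Qed.

Lemma ramanujan_sum1 (n : int) : ramanujan_sum R 1 n = 1.
Proof.
rewrite /ramanujan_sum big_ltn_cond//= big_geq// addr0.
rewrite -[X in expi X]add0r divr1 mulr1 expiD2pi.
by rewrite /expi cos0 sin0.
Qed.

End Ramanujan.

(** * Frame coefficients and the uncertainty principle *)

Section Frame.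
Variables (R : realType) (p d K : nat) (q : K.-tuple nat).
Hypotheses (N0 : (0 < p * d)%N).
Hypothesis q_dvd : forall m : nat, (m \in q) = (m %| p * d)%N.

(** Conjugating a Ramanujan sum reverses its argument, which turns the shift in the inner product
    into the reflection in the convolution. *)
Lemma circ_conv_ramanujan (h : ell2 R (p * d)) (j : 'I_d * 'I_K) :
  (0 < p)%N ->
  periodize (circ_conv h (ramanujan R (p * d) (tnth q j.2))) (p * j.1)%N%:Z =
  inner h (ramanujan_family R p d q j).
Proof.
move=> p0; have pj : (p * j.1 < p * d)%N by rewrite ltn_pmul2l.
have qN : (tnth q j.2 %| p * d)%N by rewrite -q_dvd mem_tnth.
rewrite /periodize modz_small ?ltz_nat ?pj// insubT ffunE /=.
apply: eq_bigr => m _; rewrite ffunE !periodize_ramanujan//.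
by rewrite ramanujan_sum_conj opprB.
Qed.

Lemma norm_inner_family_le (h : ell2 R (p * d)) (j : 'I_d * 'I_K) :
  `|inner h (ramanujan_family R p d q j)| <=
  (totient (p * d))%:R * \sum_(m in noise_support h) `|h m|.
Proof.
have qN : (tnth q j.2 %| p * d)%N by rewrite -q_dvd mem_tnth.
rewrite /inner (bigID (mem (noise_support h))) /=.
rewrite [X in _ + X]big1 ?addr0; last first.
  by move=> m; rewrite inE negbK => /eqP ->; rewrite mul0r.
apply: le_trans (ler_norm_sum _ _ _) _; rewrite mulr_sumr.
apply: ler_sum => m _; rewrite normrM mulrC ler_wpM2r// norm_conjC.
rewrite ffunE periodize_ramanujan//.
apply: le_trans (norm_ramanujan_sum_le _ _ _ _) _.
  exact: dvdn_gt0 qN.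
by rewrite ler_nat leq_totient_dvdn.
Qed.

Lemma inner_self (x : ell2 R (p * d)) : inner x x = \sum_m `|x m| ^+ 2.
Proof. by apply: eq_bigr => m _; rewrite normCK. Qed.

(* Testing the frame identity on the constant signal 1: the members L_{pk} c_1
   alone contribute d (pd)^2. *)
Lemma frame_bound_ge (A : R) :
  (forall x : ell2 R (p * d),
     \sum_j `|inner x (ramanujan_family R p d q j)| ^+ 2 =
     A%:C%C * inner x x) ->
  (p * d * d)%:R <= A.
Proof.
move=> /(_ [ffun=> 1]) AE.
have : (1%N \in q) by rewrite q_dvd dvd1n.
move=> /tnthP[i0 qi0].
have self1 : inner ([ffun=> 1] : ell2 R (p * d)) [ffun=> 1] = (p * d)%:R.
  rewrite inner_self; under eq_bigr do rewrite ffunE normr1 expr1n.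
  by rewrite sumr_const card_ord.
have innerE (k : 'I_d) :
    inner ([ffun=> 1] : ell2 R (p * d)) (ramanujan_family R p d q (k, i0)) =
    (p * d)%:R.
  rewrite /inner -[X in X%:R]card_ord -sumr_const; apply: eq_bigr => m _.
  by rewrite !ffunE /= -qi0 periodize_ramanujan// ramanujan_sum1 rmorph1 mulr1.
have : (p * d * d)%:R * (p * d)%:R <= A%:C%C * (p * d)%:R :> R[i].
  (* Keep only the members built from the divisor 1; the other terms are nonnegative. *)
  rewrite -self1 -AE (bigID (fun j => j.2 == i0)) /= self1 ler_wpDr ?sumr_ge0//.
  rewrite -(pair_big_dep xpredT (fun _ i => i == i0)
    (fun k i => `|inner [ffun=> 1] (ramanujan_family R p d q (k, i))| ^+ 2)) /=.
  under eq_bigr do rewrite big_pred1_eq innerE normr_nat.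
  by rewrite sumr_const card_ord -[leRHS]mulr_natr -natrX -!natrM -mulnn mulnAC.
rewrite ler_pM2r ?ltr0n//.
by rewrite -(rmorph_nat (real_complex R)) lecR.
Qed.

Lemma uncertainty (M : {set 'I_d * 'I_K}) (h : ell2 R (p * d)) :
  (0 < p)%N -> tight_frame (ramanujan_family R p d q) ->
  in_S q M h -> h != 0 ->
  (p * d * d)%:R <=
    #|M|%:R * #|noise_support h|%:R * (totient (p * d))%:R ^+ 2 :> R.
Proof.
move=> p0 [A A0 AE] hS h0; apply: le_trans (frame_bound_ge _ AE) _.
(* Positivity allows [inner h h] to be cancelled from the frame identity below. *)
have hh0 : 0 < inner h h.
  rewrite inner_self lt_def sumr_ge0 ?andbT; last by move=> *; rewrite exprn_ge0.
  apply: contra h0; rewrite psumr_eq0; last by move=> *; rewrite exprn_ge0.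
  move=> /allP h0; apply/eqP/ffunP => m; rewrite ffunE.
  by have := h0 m (mem_index_enum _); rewrite sqrf_eq0 normr_eq0 => /eqP.
rewrite -lecR -(ler_pM2r hh0) -AE.
rewrite (bigID (mem M)) /= [X in _ + X]big1 ?addr0; last first.
  move=> j jM; rewrite -circ_conv_ramanujan// hS ?inE//.
  by rewrite normr0 expr0n.
have bound (j : 'I_d * 'I_K) :
    `|inner h (ramanujan_family R p d q j)| ^+ 2 <=
    (totient (p * d))%:R ^+ 2 * (#|noise_support h|%:R * inner h h).
  apply: le_trans (_ : _ <=
    ((totient (p * d))%:R * \sum_(m in noise_support h) `|h m|) ^+ 2) _.
    rewrite lerXn2r ?nnegrE ?mulr_ge0 ?sumr_ge0//; exact: norm_inner_family_le.
  (* Cauchy-Schwarz on the support trades the squared 1-norm for the support size times the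
     energy. *)
  rewrite exprMn ler_wpM2l ?exprn_ge0//.
  apply: le_trans (sqr_sum_norm_le _ _ _ _) _; rewrite ler_wpM2l// inner_self.
  rewrite [leRHS](bigID (mem (noise_support h))) /= lerDl sumr_ge0//.
apply: (@le_trans _ _ _ _ _ (ler_sum _ (fun j _ => bound j))).
rewrite sumr_const -[leLHS]mulr_natl !rmorphM /= !rmorph_nat.
by rewrite le_eqVlt; apply/orP; left; apply/eqP; ring.
Qed.

End Frame.

(** * Differences of signals and exact recovery *)

Lemma periodizeB (R : realType) (N : nat) (x y : ell2 R N) (n : int) :
  periodize (x - y) n = periodize x n - periodize y n.
Proof. by rewrite /periodize; case: insub => [i|]; rewrite ?subr0// !ffunE. Qed.

Lemma circ_convBl (R : realType) (N : nat) (x y c : ell2 R N) :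
  circ_conv (x - y) c = circ_conv x c - circ_conv y c.
Proof.
apply/ffunP => n; rewrite !ffunE -sumrB; apply: eq_bigr => m _.
by rewrite !ffunE mulrBl.
Qed.

Lemma in_SB (R : realType) (p d K : nat) (q : K.-tuple nat)
    (M : {set 'I_d * 'I_K}) (x y : ell2 R (p * d)) :
  in_S q M x -> in_S q M y -> in_S q M (x - y).
Proof.
by move=> xS yS j jM; rewrite circ_convBl periodizeB xS// yS// subr0.
Qed.

Lemma card_noise_supportB (R : realType) (N : nat) (x y : ell2 R N) :
  (#|noise_support (x - y)%R| <= #|noise_support x| + #|noise_support y|)%N.
Proof.
apply: leq_trans (leq_card_setU _ _); apply/subset_leq_card/fintype.subsetP => m.
rewrite !inE !ffunE; apply: contraNT.
rewrite negb_or !negbK => /andP[/eqP-> /eqP->].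
by rewrite subr0.
Qed.

(* Exact recovery: a single decoder, chosen before the signal and the noise and
   applied to the observation x + eta alone, returns x. *)
Theorem theorem3p3 (R : realType) (p d : nat) (hp : (0 < p)%N) (hd : (0 < d)%N)
    (K : nat) (q : K.-tuple nat) (q_uniq : uniq q)
    (q_divisors : forall m : nat, (m \in q) = (m %| p * d)%N)
    (frame : tight_frame (ramanujan_family R p d q))
    (M : {set 'I_d * 'I_K}) :
  exists recover : ell2 R (p * d) -> ell2 R (p * d),
    forall x eta : ell2 R (p * d),
      in_S q M x ->
      2 * #|M|%:R * #|noise_support eta|%:R
        < p%:R * (d%:R / (totient (p * d))%:R) ^+ 2 :> R ->
      recover (x + eta) = x.
Proof.
have N0 : (0 < p * d)%N by rewrite muln_gt0 hp.
(* A candidate for [y] is a signal whose implied noise [y - x] obeys the sparsity bound; uniqueness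
   of candidates gives recovery. *)
pose admissible (y x : ell2 R (p * d)) := in_S q M x /\
  2 * #|M|%:R * #|noise_support (y - x)|%:R
    < p%:R * (d%:R / (totient (p * d))%:R) ^+ 2 :> R.
have admissible_inj y x x' : admissible y x -> admissible y x' -> x = x'.
  move=> [xS xN] [x'S x'N]; apply/eqP; rewrite -subr_eq0; apply/negPn/negP => h0.
  have hS := in_SB _ _ _ _ _ _ _ _ xS x'S.
  have := uncertainty _ _ _ _ _ N0 q_divisors _ _ hp frame hS h0.
  apply/negP; rewrite -ltNge.
  have t0 : (0 : R) < (totient (p * d))%:R ^+ 2.
    by rewrite exprn_gt0// ltr0n totient_gt0.
  have -> : (p * d * d)%:R = p%:R * (d%:R / (totient (p * d))%:R) ^+ 2 *
      (totient (p * d))%:R ^+ 2 :> R.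
    by rewrite expr_div_n -(mulrA p%:R) mulfVK ?gt_eqF// !natrM expr2 mulrA.
  rewrite ltr_pM2r//.
  (* Adding the two noise bounds doubles the right side, which cancels the factor 2 of the
     hypothesis. *)
  have := ltrD xN x'N; rewrite -mulrDr -natrD -mulr2n -[ltRHS]mulr_natl.
  rewrite -!mulrA ltr_pM2l//; apply: le_lt_trans; rewrite ler_wpM2l// ler_nat.
  have -> : x - x' = (y - x') - (y - x) by rewrite opprB [RHS]addrC subrKA.
  by rewrite addnC card_noise_supportB.
(* The decoder chooses any candidate; the value 0 is returned only for observations that have
   none. *)
exists (fun y => if pselect (exists x, admissible y x) is left ex
                 then projT1 (cid ex) else 0).
move=> x eta xS xN.
have adm : admissible (x + eta) x by split=> //; rewrite addrC addKr.
case: pselect => [ex|[]]; last by exists x.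
exact: admissible_inj (projT2 (cid ex)) adm.
Qed.
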